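(* Let $a<b$ be real numbers, let $u:[a,b]\to[0,\infty)$ be of bounded variation on $[a,b]$, and let $f:[a,b]\to\mathbb{R}$ be monotonic nondecreasing on $[a,b]$. Then $$\left|\frac13\left\{\left[u\left(\tfrac{a+b}{2}\right)-u(a)\right]f(a)+2[u(b)-u(a)]f\left(\tfrac{a+b}{2}\right)+\left[u(b)-u\left(\tfrac{a+b}{2}\right)\right]f(b)\right\}-\int_a^b f(t)\,du(t)\right|$$ $$\le\frac23\left\{\left[f\left(\tfrac{a+b}{2}\right)-f(a)\right]\cdot\bigvee_a^{\frac{a+b}{2}}(u)+\left[f(b)-f\left(\tfrac{a+b}{2}\right)\right]\cdot\bigvee_{\frac{a+b}{2}}^b(u)\right\}$$ $$\le\frac23\left[\frac{f(b)-f(a)}{2}+\left|f\left(\tfrac{a+b}{2}\right)-\frac{f(a)+f(b)}{2}\right|\right]\cdot\bigvee_a^b(u).$$ For the last inequality (i.e. the bound of the first quantity by the last one), the constant $\frac23$ is the best possible: it cannot be replaced by a smaller constant for which the bound still holds for all such $u,f$.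
   Context: $\bigvee_c^d(u)$ denotes the total variation of $u$ over $[c,d]$. Integrals with respect to $du$ are Riemann–Stieltjes integrals.
   Formalization: The Riemann–Stieltjes integral of f with respect to u is assumed to exist (as the limit of sums when the mesh tends to 0) wherever it appears; it can fail to exist when f and u share a discontinuity, e.g. f = u = indicator of [c,b] with a < c < b. *)

(* Defs.v *)
From mathcomp Require Import all_boot all_order all_algebra.
From mathcomp Require Import all_classical all_reals all_analysis.

Set Implicit Arguments.
Unset Strict Implicit.
Unset Printing Implicit Defensive.

Import Order.TTheory GRing.Theory Num.Theory.
Local Open Scope ring_scope.

Section RiemannStieltjes.
Context {R : realType}.
Implicit Types (a b I : R) (f u : R -> R) (s : seq R) (t : nat -> R).

(* As in [variation], the points of a partition [s] of [a, b] are
   x_i = nth b (a :: s) i for 0 <= i <= size s; t_i is the tag of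
   [x_i, x_i.+1], and only the tags with i < size s matter. *)
Definition itv_tags a b s t :=
  forall i, (i < size s)%N ->
    nth b (a :: s) i <= t i <= nth b (a :: s) i.+1.

Definition mesh_lt a b s (d : R) :=
  forall i, (i < size s)%N ->
    nth b (a :: s) i.+1 - nth b (a :: s) i < d.

Definition RS_sum a b f u s t :=
  \sum_(0 <= i < size s)
    f (t i) * (u (nth b (a :: s) i.+1) - u (nth b (a :: s) i)).

(* The integral of f with respect to du over [a, b] exists in the
   Riemann-Stieltjes sense, as a limit when the mesh tends to 0, and is I. *)
Definition is_RS_integral a b f u I :=
  forall e : R, 0 < e -> exists2 d : R, 0 < d &
    forall s t, itv_partition a b s -> mesh_lt a b s d -> itv_tags a b s t ->
      `|RS_sum a b f u s t - I| < e.

End RiemannStieltjes.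

Section Bounds.
Context {R : realType}.
Implicit Types (a b I : R) (f u : R -> R).

(* I stands for the integral of f with respect to du. *)
Definition rule_error a b u f I : R :=
  let m := (a + b) / 2 in
  `| 1 / 3 * ((u m - u a) * f a + 2 * (u b - u a) * f m + (u b - u m) * f b)
     - I |.

(* For u of bounded variation the extended real [total_variation c d u] is
   finite, so [fine] loses nothing. *)
Definition tv c d u : R := fine (total_variation c d u).

Definition split_bound a b u f : R :=
  let m := (a + b) / 2 in
  (f m - f a) * tv a m u + (f b - f m) * tv m b u.

Definition global_bound a b u f : R :=
  let m := (a + b) / 2 in
  ((f b - f a) / 2 + `|f m - (f a + f b) / 2|) * tv a b u.

End Bounds.

(* Main.v *)
Require Import Defs.
From mathcomp Require Import all_boot all_order all_algebra.
From mathcomp Require Import all_classical all_reals all_analysis.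
From mathcomp Require Import ring lra.
Import Order.TTheory GRing.Theory Num.Theory.
Local Open Scope ring_scope.

(** Writing [m = (a + b) / 2], the error is the integral with respect to [du]
    of [(f a + 2 f m) / 3 - f] over [[a, m]] plus that of
    [(2 f m + f b) / 3 - f] over [[m, b]].  By monotonicity the integrands are
    at most [2 / 3 * (f m - f a)] and [2 / 3 * (f b - f m)] in absolute value,
    which gives the first bound, for Riemann-Stieltjes sums and then in the
    limit.  Equality between the two extreme terms holds for [u] the indicator
    of [x > a] and [f] the indicator of [x >= m]: the jump of [u] sits at the
    point where the first integrand attains its bound. *)

Section Partitions.
Context {R : realType}.
Implicit Types (a b c d k K : R) (f u : R -> R) (s : seq R) (t : nat -> R).

(** Cut into [n.+1] equal pieces: truncation gives [(b - a) / d < n.+1], so the step [h] is below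
    [d]. Without such a partition the definition of the integral would yield no estimate. *)
Lemma exists_itv_partition_mesh_lt a b d : a < b -> 0 < d ->
  exists s, itv_partition a b s /\ mesh_lt a b s d.
Proof.
move=> ab d0; pose n := Num.truncn ((b - a) / d); pose h := (b - a) / n.+1%:R.
have n0 : 0 < n.+1%:R :> R by rewrite ltr0n.
have h0 : 0 < h by rewrite divr_gt0// subr_gt0.
have hd : h < d.
  rewrite ltr_pdivrMr// mulrC -ltr_pdivrMr//.
  exact: truncnS_gt.
pose x (i : nat) := a + h * i%:R; pose s := mkseq (fun i => x i.+1) n.+1.
have sx i : (i <= n.+1)%N -> nth b (a :: s) i = x i.
  case: i => [_|i ip]; first by rewrite /x mulr0 addr0.
  by rewrite /= nth_mkseq.
have xS i : x i.+1 = x i + h by rewrite /x -natr1; ring.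
exists s; split; last first.
  move=> i; rewrite size_mkseq => ip.
  by rewrite !sx ?(ltnW ip)// xS addrC addKr.
split.
  apply/(pathP b) => i; rewrite size_mkseq => ip.
  by rewrite sx ?(ltnW ip)// nth_mkseq// xS ltrDl.
have := sx n.+1 (leqnn _).
rewrite -[X in nth _ _ X](size_mkseq (fun i => x i.+1) n.+1) -/s -last_nth => ->.
by rewrite /x /h divfK ?lt0r_neq0// addrC subrK.
Qed.

Lemma nth_cat_left a b c s1 s2 i : (i <= size s1)%N ->
  nth b (a :: s1 ++ s2) i = nth c (a :: s1) i.
Proof.
move=> i1; rewrite -cat_cons nth_cat /= ltnS i1.
exact: set_nth_default.
Qed.

(** The index [size s1] is the junction: the last point of [a :: s1] is the head of [c :: s2]. *)
Lemma nth_cat_right a b c s1 s2 i : last a s1 = c ->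
  nth b (a :: s1 ++ s2) (size s1 + i) = nth b (c :: s2) i.
Proof.
move=> <-; case: i => [|i].
  by rewrite addn0 (@nth_cat_left _ _ b)//= (last_nth b).
by rewrite addnS /= nth_cat ltnNge leq_addr /= addKn.
Qed.

Lemma mesh_lt_cat a b c s1 s2 d : last a s1 = c ->
  mesh_lt a c s1 d -> mesh_lt c b s2 d -> mesh_lt a b (s1 ++ s2) d.
Proof.
move=> s1c m1 m2 i; rewrite size_cat => ip.
have [i1|i1] := ltnP i (size s1).
  by rewrite !(@nth_cat_left _ _ c) ?(ltnW i1)//; exact: m1.
rewrite -(subnKC i1) -addnS !(@nth_cat_right _ _ c)//.
by apply: m2; rewrite ltn_subLR.
Qed.

Lemma itv_tags_left a b s : itv_partition a b s ->
  itv_tags a b s (nth b (a :: s)).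
Proof.
by move=> [/(pathP b) sP _] i ip; rewrite lexx /= ltW// sP.
Qed.

(** Left endpoints as tags are compatible with concatenation: no interval straddles [c], so each one
    keeps its tag. *)
Lemma RS_sum_left_cat a b c f u s1 s2 : last a s1 = c ->
  RS_sum a b f u (s1 ++ s2) (nth b (a :: s1 ++ s2)) =
  RS_sum a c f u s1 (nth c (a :: s1)) + RS_sum c b f u s2 (nth b (c :: s2)).
Proof.
move=> s1c; rewrite /RS_sum size_cat.
rewrite (@big_cat_nat _ _ _ (size s1)) ?leq_addr//; congr (_ + _).
  rewrite !big_nat; apply: eq_bigr => i /andP[_ i1].
  by rewrite !(@nth_cat_left _ _ c) ?(ltnW i1).
rewrite -[X in index_iota X _]add0n big_addn addKn.
apply: eq_bigr => i _; rewrite [(i + _)%N]addnC -addnS.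
by rewrite !(@nth_cat_right _ _ c).
Qed.

(** The term [k * (u b - u a)] telescopes over the partition, so the difference is a sum of
    increments of [u] weighted by [k - f (t i)]. No passage to the limit is involved. *)
Lemma RS_sum_tv_bound a b k K f u s t : bounded_variation a b u ->
  itv_partition a b s -> itv_tags a b s t ->
  (forall x, a <= x <= b -> `|k - f x| <= K) ->
  `|k * (u b - u a) - RS_sum a b f u s t| <= K * tv a b u.
Proof.
move=> bvu sp st fK; have ab := itv_partition_le sp.
have K0 : 0 <= K by rewrite (le_trans _ (fK a _)) ?lexx.
have -> : k * (u b - u a) =
    \sum_(0 <= i < size s)
      k * (u (nth b (a :: s) i.+1) - u (nth b (a :: s) i)).
  rewrite -mulr_sumr (telescope_sumr (fun i => u (nth b (a :: s) i)))//.
  by rewrite (itv_partition_nth_size _ sp).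
rewrite /RS_sum -sumrB (le_trans (ler_norm_sum _ _ _))//.
apply: (@le_trans _ _ (K * variation a b u s)).
  rewrite /variation mulr_sumr !big_nat; apply: ler_sum => i /andP[_ ip].
  rewrite -mulrBl normrM ler_wpM2r// fK//.
  have /andP[ti it] := st _ ip.
  rewrite (le_trans (itv_partition_nth_ge _ sp) ti) ?ltnS ?(ltnW ip)//=.
  exact: le_trans it (itv_partition_nth_le _ sp).
rewrite ler_wpM2l// /tv -lee_fin fineK; last exact/bounded_variationP.
apply: ereal_sup_ubound; exists (variation a b u s) => //.
exact: variations_variation.
Qed.

End Partitions.

(** Once the mesh is below [c - a], every sum vanishes: the first tag lies left of [c], where the
    integrand is 0, and on later intervals both ends exceed [a], so [u] is constant. *)
Lemma is_RS_integral_jump (R : realType) (a b c : R) : a < c ->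
  is_RS_integral a b (fun x => (c <= x)%R%:R : R) (fun x => (a < x)%R%:R : R) 0.
Proof.
move=> ac e e0; exists (c - a); first by rewrite subr_gt0.
move=> s t [sp _] sm st; rewrite subr0 /RS_sum.
have sa x : x \in s -> a < x.
  by move: x; exact/allP/(order_path_min lt_trans sp).
rewrite big_nat big1 ?normr0// => i /andP[_ ip].
case: i ip => [|i] ip /=; last first.
  by rewrite !sa ?subrr ?mulr0// mem_nth// ltnW.
have /andP[_ t0] := st _ ip; have /= m0 := sm _ ip.
rewrite leNgt (_ : t 0%N < c) ?mul0r//.
by rewrite (le_lt_trans t0)// -(ltrD2r (- a)).
Qed.

Lemma rule_error_le_split_bound (R : realType) (a b I : R) (u f : R -> R) :
  a < b -> bounded_variation a b u ->
  {in `[a, b] &, {homo f : x y / x <= y}} -> is_RS_integral a b f u I ->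
  rule_error a b u f I <= 2 / 3 * split_bound a b u f.
Proof.
move=> ab bvu fnd fuI; rewrite /rule_error /split_bound.
set m := (a + b) / 2.
have am : a < m by rewrite /m; lra.
have mb : m < b by rewrite /m; lra.
have fle x y : a <= x -> x <= y -> y <= b -> f x <= f y.
  by move=> ax xy yb; apply: fnd; rewrite ?in_itv/= ?ax ?yb ?(le_trans ax)
    ?(le_trans xy).
apply/ler_addgt0Pr => e e0; have [d d0 dI] := fuI _ e0.
(* Gluing partitions of the two halves makes [m] a partition point, so the sum splits there. *)
have [s1 [p1 m1]] := exists_itv_partition_mesh_lt _ _ _ am d0.
have [s2 [p2 m2]] := exists_itv_partition_mesh_lt _ _ _ mb d0.
have s1m : last a s1 = m by case: p1 => _ /eqP.
have p12 := itv_partition_cat p1 p2.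
have := dI _ _ p12 (mesh_lt_cat _ _ _ _ _ _ s1m m1 m2)
  (itv_tags_left _ _ _ p12).
rewrite (RS_sum_left_cat _ _ _ _ _ _ _ s1m) => SI.
(* The constant lies two thirds of the way from [f a] to [f m]; its farthest value of [f] is
   [f a]. *)
have B1 : forall x, a <= x <= m ->
    `|(f a + 2 * f m) / 3 - f x| <= 2 / 3 * (f m - f a).
  move=> x /andP[ax xm]; rewrite ler_norml.
  have := fle _ _ (lexx a) ax (le_trans xm (ltW mb)).
  have := fle _ _ ax xm (ltW mb).
  by move=> ? ?; apply/andP; split; lra.
have B2 : forall x, m <= x <= b ->
    `|(2 * f m + f b) / 3 - f x| <= 2 / 3 * (f b - f m).
  move=> x /andP[mx xb]; rewrite ler_norml.
  have := fle _ _ (ltW am) mx xb.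
  have := fle _ _ (le_trans (ltW am) mx) xb (lexx b).
  by move=> ? ?; apply/andP; split; lra.
have S1 := RS_sum_tv_bound _ _ _ _ _ _ _ _
  (bounded_variationl (ltW am) (ltW mb) bvu) p1 (itv_tags_left _ _ _ p1) B1.
have S2 := RS_sum_tv_bound _ _ _ _ _ _ _ _
  (bounded_variationr (ltW am) (ltW mb) bvu) p2 (itv_tags_left _ _ _ p2) B2.
(* The two constants times the increments of [u] over the halves add up to the quadrature rule. *)
move: S1 S2 SI; rewrite ltr_norml !ler_norml.
move=> /andP[S1 S1'] /andP[S2 S2'] /andP[SI SI'].
by apply/andP; split; lra.
Qed.

(** With [p = f m - f a] and [q = f b - f m], the factor in [global_bound] is
    [(p + q) / 2 + |p - q| / 2], the maximum of [p] and [q]; the total variation is additive at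
    [m]. *)
Lemma split_bound_le_global_bound (R : realType) (a b : R) (u f : R -> R) :
  a < b -> bounded_variation a b u ->
  split_bound a b u f <= global_bound a b u f.
Proof.
move=> ab bvu; rewrite /split_bound /global_bound; set m := (a + b) / 2.
have am : a <= m by rewrite /m; lra.
have mb : m <= b by rewrite /m; lra.
have -> : tv a b u = tv a m u + tv m b u.
  rewrite /tv (total_variationD u am mb) fineD//; apply/bounded_variationP => //.
    exact: (bounded_variationl am mb).
  exact: (bounded_variationr am mb).
have ge0_tv c d : c <= d -> 0 <= tv c d u.
  by move=> cd; exact/fine_ge0/total_variation_ge0.
rewrite mulrDr lerD// ler_wpM2r ?ge0_tv//.
  by have := ler_norm (f m - (f a + f b) / 2); lra.
by have := ler_norm (- (f m - (f a + f b) / 2)); rewrite normrN; lra.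
Qed.

Theorem corollary9 (R : realType) (a b : R) (hab : a < b) :
  (forall u f : R -> R,
     (forall x : R, a <= x <= b -> 0 <= u x) ->
     bounded_variation a b u ->
     {in `[a, b] &, {homo f : x y / x <= y}} ->
     (forall I : R, is_RS_integral a b f u I ->
        rule_error a b u f I <= 2 / 3 * split_bound a b u f) /\
     2 / 3 * split_bound a b u f <= 2 / 3 * global_bound a b u f)
  /\
  (forall C : R,
     (forall (u f : R -> R) (I : R),
        (forall x : R, a <= x <= b -> 0 <= u x) ->
        bounded_variation a b u ->
        {in `[a, b] &, {homo f : x y / x <= y}} ->
        is_RS_integral a b f u I ->
        rule_error a b u f I <= C * global_bound a b u f) ->
     2 / 3 <= C).
Proof.
split=> [u f _ bvu fnd|C bound].
  split=> [I|]; first exact: rule_error_le_split_bound.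
  by rewrite ler_wpM2l ?split_bound_le_global_bound//; lra.
pose m := (a + b) / 2.
have am : a < m by rewrite /m; lra.
have mb : m < b by rewrite /m; lra.
pose u x : R := (a < x)%R%:R; pose f x : R := (m <= x)%R%:R.
have und : {in `[a, b] &, {homo u : x y / x <= y}}.
  move=> x y _ _ xy; rewrite ler_nat.
  by case: ltP => // ax; rewrite (lt_le_trans ax xy).
have fnd : {in `[a, b] &, {homo f : x y / x <= y}}.
  move=> x y _ _ xy; rewrite ler_nat.
  by case: (leP m x) => // mx; rewrite (le_trans mx xy).
have := bound u f 0 (fun x _ => ler0n _ _)
  (nondecreasing_bounded_variation und) fnd (is_RS_integral_jump _ _ _ _ am).
rewrite /rule_error /global_bound -/m /tv.
rewrite (nondecreasing_total_variation (ltW hab) und) /=.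
rewrite /u /f ltxx hab am lexx (ltW mb) (leNgt m a) am /=.
(* Only the middle term of the rule survives, and the integral is 0. On the right, the factor is
   [1 / 2 + 1 / 2] and the variation is 1, leaving [2 / 3 <= C]. *)
rewrite (_ : 1 / 3 * _ - 0 = 2 / 3 :> R); last by field.
rewrite (_ : 1 - (0 + 1) / 2 = 1 / 2 :> R); last by field.
by rewrite !ger0_norm; lra.
Qed.
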